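(* Let $\mathbb{K}$ be a field and let $\Delta$ be a simplicial complex. The following are equivalent (all notions over $\mathbb{K}$). (1) $\mathcal{B}(\Delta)$ is PR. (2) $\mathcal{B}(\Delta)$ is Cohen-Macaulay (i.e. PR with degree type $(1,\dots,1)$). (3) $\Delta$ is Cohen-Macaulay (i.e. PR with degree type $(1,\dots,1)$).
   Context: Simplicial complexes are sets of subsets of a finite vertex set closed under taking subsets. The barycentric subdivision $\mathcal{B}(\Delta)$ is the complex on vertex set $\{u_\sigma:\sigma\in\Delta\setminus\{\emptyset\}\}$ whose faces are the sets $\{u_{\sigma_1},\dots,u_{\sigma_r}\}$ with $\sigma_1\subsetneq\dots\subsetneq\sigma_r$ (including the empty face). $\widetilde{H}_i$ is reduced simplicial homology with coefficients in $\mathbb{K}$ (with $\widetilde H_{-1}(\{\emptyset\})=\mathbb{K}$), and $\mathrm{link}_\Delta\sigma=\{\tau\in\Delta:\sigma\cap\tau=\emptyset,\sigma\cup\tau\in\Delta\}$. $\Delta$ is Cohen-Macaulay (over $\mathbb{K}$) if it satisfies Reisner's criterion: for every face $\sigma\in\Delta$, $\widetilde H_i(\mathrm{link}_\Delta\sigma)=0$ for all $i\ne\dim\Delta-|\sigma|$, where $\dim\Delta=\max_{\tau\in\Delta}|\tau|-1$. $\Delta$ is PR (over $\mathbb{K}$) if for every $i\ge-1$ and all faces $\sigma,\tau\in\Delta$ with $\widetilde H_i(\mathrm{link}_\Delta\sigma)\ne0\ne\widetilde H_i(\mathrm{link}_\Delta\tau)$ we have $|\sigma|=|\tau|$. For a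 PR complex, let $p$ be the maximum index for which some face $\sigma$ has $\widetilde H_{p-1}(\mathrm{link}_\Delta\sigma)\neq0$; for each $0\le i\le p$ faces with $\widetilde H_{i-1}(\mathrm{link}_\Delta\sigma)\ne0$ exist, and $s_i$ is their common size. The degree type is $(d_p,\dots,d_1)$ with $d_i=s_{i-1}-s_i$. (Being Cohen-Macaulay is equivalent to being PR with degree type $(1,\dots,1)$, by the Eagon-Reiner Theorem; the length of this sequence, possibly $0$, is not specified.) *)

(* Defs.v *)
From HB Require Import structures.
From mathcomp Require Import all_boot all_order all_algebra.

Set Implicit Arguments.
Unset Strict Implicit.
Unset Printing Implicit Defensive.

Import GRing.Theory.
Local Open Scope ring_scope.

(* No nonemptiness is required: the void complex [set0] is allowed. *)
Definition simplicial_complex (V : finType) (D : {set {set V}}) : Prop :=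
  forall s t : {set V}, t \subset s -> s \in D -> t \in D.

Definition link (V : finType) (D : {set {set V}}) (s : {set V}) :
    {set {set V}} :=
  [set t in D | [disjoint s & t] & s :|: t \in D].

Definition dim (V : finType) (D : {set {set V}}) : int :=
  (\max_(t in D) #|t|)%N%:Z - 1.

(* The vertex [u_s] is [s] itself. A finite set of faces is strictly ordered
   by inclusion exactly when its members are pairwise comparable. *)
Definition barycentric (V : finType) (D : {set {set V}}) :
    {set {set {set V}}} :=
  [set c : {set {set V}} | (c \subset D :\ set0)
    && [forall s in c, forall t in c, (s \subset t) || (t \subset s)]].

(* Simplicial chains of all degrees, on all subsets of [V]; vertices are
   ordered by [enum_rank], which orients every simplex. *)
Notation chain V K := {ffun {set V} -> K^o}.

Section Homology.
Variables (V : finType) (K : fieldType).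

Definition simplex (s : {set V}) : chain V K := [ffun t => (t == s)%:R].

Definition vertex_pos (s : {set V}) (v : V) : nat :=
  #|[set w in s | (enum_rank w < enum_rank v)%N]|.

Definition boundary_simplex (s : {set V}) : chain V K :=
  \sum_(v in s) (-1) ^+ vertex_pos s v *: simplex (s :\ v).

Definition boundary (f : chain V K) : chain V K :=
  \sum_(s : {set V}) f s *: boundary_simplex s.

Fact boundary_is_linear : linear boundary.
Proof.
move=> a f g; rewrite /boundary scaler_sumr -big_split /=.
by apply: eq_bigr => s _; rewrite !ffunE scalerDl scalerA.
Qed.

HB.instance Definition _ :=
  GRing.isLinear.Build K (chain V K) (chain V K) *:%R boundary
    boundary_is_linear.

(* The augmented complex: the empty face spans the chains of degree -1. *)
Definition chains (D : {set {set V}}) (i : int) : {vspace chain V K} :=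
  <<[seq simplex s | s in [set s in D | (#|s|%:Z == i + 1)%R]]>>%VS.

Definition cycles (D : {set {set V}}) (i : int) : {vspace chain V K} :=
  (chains D i :&: lker (linfun boundary))%VS.

Definition boundaries (D : {set {set V}}) (i : int) : {vspace chain V K} :=
  (linfun boundary @: chains D (i + 1)%R)%VS.

(* The quotient of the cycles by the boundaries, realized as a complement of
   the boundaries inside the cycles. *)
Definition reduced_homology (D : {set {set V}}) (i : int) :
    {vspace chain V K} :=
  (cycles D i :\: boundaries D i)%VS.

End Homology.

Definition cohen_macaulay (K : fieldType) (V : finType)
    (D : {set {set V}}) : Prop :=
  forall s, s \in D -> forall i : int, i <> dim D - #|s|%:Z ->
    reduced_homology K (link D s) i = 0%VS.

Definition PR (K : fieldType) (V : finType) (D : {set {set V}}) : Prop :=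
  forall (i : int) (s t : {set V}), -1 <= i -> s \in D -> t \in D ->
    reduced_homology K (link D s) i <> 0%VS ->
    reduced_homology K (link D t) i <> 0%VS ->
    #|s| = #|t|.

Section DegreeType.
Variables (K : fieldType) (V : finType) (D : {set {set V}}).

(* The faces [s] with nonzero [H_(i-1)] of the link. *)
Definition level (i : nat) : {set {set V}} :=
  [set s in D | reduced_homology K (link D s) (i%:Z - 1) != 0%VS].

(* No level above [#|V|] is inhabited: there are no chains in that degree. *)
Definition max_level : nat :=
  (\max_(i < #|V|.+1 | level i != set0) i)%N.

(* The common size of the faces in [level i] when [D] is PR. *)
Definition level_size (i : nat) : nat := (\max_(s in level i) #|s|)%N.

Definition degree_type : seq int :=
  [seq (level_size i.-1)%:Z - (level_size i)%:Z
     | i <- rev (iota 1 max_level)].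

End DegreeType.

Definition PR_of_degree_type (K : fieldType) (V : finType)
    (D : {set {set V}}) (d : seq int) : Prop :=
  PR K D /\ degree_type K D = d.

(* Main.v *)
(* For a flag c of nonempty faces with union s, the homology of the link of c
   in the subdivision is that of the link of s in D, shifted by |s| - |c|.
   If c is not a full flag of s, pick consecutive members lo, hi of c with
   |hi| > |lo| + 1 and v in hi but not in lo: deleting the vertex hi - v from
   the link of c leaves an acyclic complex, so the link of c is homologically
   the suspension of the link of c + {hi - v}.  If c is a full flag of s, the
   link of c is the complex of flags of faces strictly above s, and both it and
   the link of s are retracts of a mapping cylinder.
   This transfers the Cohen-Macaulay property to the subdivision.  Conversely,
   if the link of s has homology in degree i, then so has the link of a flag
   of size |s|, and, inside a largest face F, so has the link of a flag of size
   dim D - i; the PR property then forces |s| = dim D - i. *)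
Require Import Defs.
From HB Require Import structures.
From mathcomp Require Import all_boot all_order all_algebra.
From mathcomp Require Import zify ring.

Set Implicit Arguments.
Unset Strict Implicit.
Unset Printing Implicit Defensive.

Import GRing.Theory.
Local Open Scope ring_scope.

(** * Chains *)

Section Chains.
Variables (V : finType) (K : fieldType).
Implicit Types (f g z : chain V K) (s t u : {set V}) (v a : V).
Implicit Types (X Y : {set {set V}}) (i : int).

(** A vertex does not count towards its own position, so for [v \notin t] this is also the sign of
    [v] in [v |: t]. *)
Definition orient t v : K := (-1) ^+ vertex_pos t v.

Lemma orient2 t v : orient t v * orient t v = 1.
Proof. by rewrite /orient -expr2 sqrr_sign. Qed.

Lemma vertex_posD1 s v : vertex_pos (s :\ v) v = vertex_pos s v.
Proof.
rewrite /vertex_pos; apply: eq_card => w; rewrite !inE.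
by case: (eqVneq w v) => [->|]; rewrite ?ltnn ?andbF.
Qed.

Lemma vertex_posU1 t v a : v != a -> v \notin t ->
  vertex_pos (v |: t) a = ((enum_rank v < enum_rank a) + vertex_pos t a)%N.
Proof.
move=> va vt; rewrite /vertex_pos (cardsD1 v) !inE eqxx /=; congr (_ + _)%N.
apply: eq_card => w; rewrite !inE.
by case: eqVneq => [->|//]; rewrite (negPf vt).
Qed.

Lemma ltn_enum_rankC v a : v != a ->
  (enum_rank v < enum_rank a)%N = ~~ (enum_rank a < enum_rank v)%N.
Proof.
move=> va; have: enum_rank v != enum_rank a :> nat.
  by apply: contra va => /eqP/ord_inj/enum_rank_inj->.
lia.
Qed.

(** Exactly one of [v], [a] precedes the other, so exactly one of the two insertions shifts a
    position. *)
Lemma orient_swap t v a : v != a -> v \notin t -> a \notin t ->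
  orient t v * orient (v |: t) a = - (orient t a * orient (a |: t) v).
Proof.
move=> va vt at_; rewrite /orient !vertex_posU1 // 1?eq_sym // !exprD.
have : (enum_rank v < enum_rank a)%N = ~~ (enum_rank a < enum_rank v)%N.
  by apply: ltn_enum_rankC.
move->; case: (_ < _)%N; rewrite /= ?expr0 ?expr1 !mulN1r ?mul1r ?mulrN ?opprK;
  by rewrite mulrC.
Qed.

Lemma boundaryE f t :
  boundary f t = \sum_(v | v \notin t) orient t v * f (v |: t).
Proof.
rewrite /boundary sum_ffunE.
transitivity (\sum_(s : {set V}) \sum_(v in s)
    f s * ((-1) ^+ vertex_pos s v * (t == s :\ v)%:R)).
  apply: eq_bigr => s _; rewrite !ffunE sum_ffunE scaler_sumr.
  by apply: eq_bigr => v _; rewrite !ffunE.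
rewrite (exchange_big_dep predT) //= [RHS]big_mkcond /=; apply: eq_bigr => v _.
case: ifPn => [vt|]; last first.
  rewrite negbK => vt; apply: big1 => s _.
  case: eqP => [e|_]; last by rewrite !mulr0.
  by rewrite e !inE eqxx in vt.
rewrite (bigD1 (v |: t)) ?setU11 //= setU1K // eqxx mulr1 big1 ?addr0.
  by rewrite mulrC /orient -vertex_posD1 setU1K.
move=> s /andP[vs ns]; case: eqP => [e|_]; last by rewrite !mulr0.
by rewrite e setD1K ?eqxx in ns.
Qed.

Definition supported X i f :=
  forall t, f t != 0 -> t \in X /\ #|t|%:Z = i + 1.

Lemma chainsP X i f : reflect (supported X i f) (f \in chains K X i).
Proof.
rewrite /chains; set S := [seq _ | _ in _]; apply: (iffP idP) => [fS t|fX].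
  rewrite (coord_span fS) sum_ffunE => ft.
  suff /hasP[_ /imageP[s sS ->] /=] : has (fun g : chain V K => g t != 0) S.
    move: sS; rewrite inE ffunE => /andP[sX /eqP ss].
    by case: (eqVneq t s) => [-> _|_]; [split|rewrite eqxx].
  apply: contraNT ft; rewrite -all_predC => /allP n; apply/eqP.
  apply: big1 => k _; have /n : S`_k \in S by rewrite mem_nth // size_map -cardE.
  by rewrite /= negbK ffunE => /eqP->; rewrite scaler0.
have -> : f = \sum_s f s *: simplex K s.
  apply/ffunP => t; rewrite sum_ffunE (bigD1 t) //= !ffunE eqxx.
  rewrite [f t *: _]mulr1 big1 ?addr0 //.
  by move=> s /negPf st; rewrite !ffunE eq_sym st scaler0.
apply: memv_suml => s _; have [->|fs] := eqVneq (f s) 0; first by rewrite scale0r mem0v.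
apply/memvZ/memv_span; have [sX ss] := fX s fs.
by apply: image_f; rewrite inE sX ss eqxx.
Qed.

(** Vanishing homology phrased by chains and not by subspaces, so that bounding chains can be built
    by hand. *)
Definition acyclic_at X i := forall z, supported X i z -> boundary z = 0 ->
  exists2 w, supported X (i + 1) w & boundary w = z.

Lemma homology0P X i : reduced_homology K X i = 0%VS <-> acyclic_at X i.
Proof.
split=> [/eqP|H].
  rewrite /reduced_homology diffv_eq0 => /subvP H z zX dz.
  have /H/memv_imgP[w /chainsP wX ->] : z \in cycles K X i.
    by rewrite memv_cap memv_ker lfunE /= dz eqxx andbT; apply/chainsP.
  by exists w => //; rewrite lfunE.
apply/eqP; rewrite /reduced_homology diffv_eq0; apply/subvP => z.
rewrite memv_cap memv_ker lfunE /= => /andP[/chainsP zX /eqP dz].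
have [w wX <-] := H z zX dz; apply/memv_imgP; exists w; first exact/chainsP.
by rewrite lfunE.
Qed.

Lemma supportedD X i f g :
  supported X i f -> supported X i g -> supported X i (f + g).
Proof. by move=> /chainsP fX /chainsP gX; apply/chainsP; apply: memvD. Qed.

Lemma supportedN X i f : supported X i f -> supported X i (- f).
Proof. by move=> /chainsP fX; apply/chainsP; rewrite memvN. Qed.

Lemma supportedB X i f g :
  supported X i f -> supported X i g -> supported X i (f - g).
Proof. by move=> fX gX; apply/supportedD/supportedN. Qed.

Lemma supportedS X Y i f : X \subset Y -> supported X i f -> supported Y i f.
Proof. by move=> /subsetP XY fX t /fX[/XY]. Qed.

Lemma supported0 X i : supported X i 0.
Proof. by move=> t; rewrite ffunE eqxx. Qed.

Lemma supported_boundary X i f : simplicial_complex X ->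
  supported X (i + 1) f -> supported X i (boundary f).
Proof.
move=> cX fX t; rewrite boundaryE => nz.
have /existsP[v /andP[vt fv]] : [exists v, (v \notin t) && (f (v |: t) != 0)].
  apply: contraNT nz; rewrite negb_exists => /forallP n; apply/eqP.
  apply: big1 => v vt; have := n v; rewrite vt /= negbK => /eqP->.
  by rewrite mulr0.
have [vtX] := fX _ fv; rewrite cardsU1 vt => e; split; last by lia.
by apply: cX vtX; apply: subsetUr.
Qed.

Lemma boundary_boundary f : boundary (boundary f) = 0.
Proof.
apply/ffunP => t; rewrite boundaryE ffunE.
pose F v w := orient t v * (orient (v |: t) w * f (w |: (v |: t))).
pose lt (v w : V) := (enum_rank v < enum_rank w)%N.
transitivity (\sum_(v | v \notin t) \sum_(w | (w \notin t) && (w != v)) F v w).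
  apply: eq_bigr => v vt; rewrite boundaryE mulr_sumr; apply: eq_bigl => w.
  by rewrite !inE negb_or andbC.
(* Ordered pairs are split by which vertex comes first; exchanging the sums in one half matches each
   pair with its reverse, of opposite sign. *)
transitivity (\sum_(v | v \notin t) (\sum_(w | (w \notin t) && lt v w) F v w
   + \sum_(w | (w \notin t) && lt w v) F v w)).
  apply: eq_bigr => v vt; rewrite (bigID (lt v)) /=; congr (_ + _); apply: eq_bigl => w.
    rewrite /lt; case: (w \notin t) => //=; case: eqVneq => [->|//].
    by rewrite ltnn.
  rewrite /lt; case: (w \notin t) => //=; case: (eqVneq w v) => [->|wv] /=.
    by rewrite ltnn.
  by rewrite [RHS]ltn_enum_rankC.
rewrite big_split /= [X in _ + X](exchange_big_dep (fun v => v \notin t)) /=; last first.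
  by move=> v w _ /andP[].
rewrite -big_split big1 // => v vt /=.
rewrite [X in _ + X](eq_bigl (fun w => (w \notin t) && lt v w)); last first.
  by move=> w; rewrite vt.
rewrite -big_split big1 //= => w /andP[wt vw].
have vw' : v != w by apply: contraTneq vw => ->; rewrite /lt ltnn.
by rewrite /F setUCA !mulrA orient_swap // mulNr addNr.
Qed.

Definition cone a f : chain V K :=
  [ffun t : {set V} => if a \in t then orient (t :\ a) a * f (t :\ a) else 0].

(** The full simplex on [V] is a cone with apex [a], and [cone a] is its contracting homotopy. *)
Lemma boundary_cone a f : boundary (cone a f) + cone a (boundary f) = f.
Proof.
apply/ffunP => t; rewrite ffunE boundaryE ffunE.
case: ifPn => at_; last first.
  rewrite addr0 (bigD1 a) //= ffunE setU11 setU1K // mulrA orient2 mul1r.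
  rewrite big1 ?addr0 // => v /andP[vt va]; rewrite ffunE !inE (negPf at_) orbF.
  by rewrite eq_sym (negPf va) mulr0.
pose u := t :\ a; have au : a \notin u by rewrite !inE eqxx.
have tE : t = a |: u by rewrite setD1K.
(* The term [v = a] of the inner boundary returns [f t]; the others cancel by [orient_swap]. *)
rewrite boundaryE -/u [X in _ + _ * X](bigD1 a) //= -tE mulrDr mulrA orient2 mul1r.
rewrite addrCA mulr_sumr.
rewrite [X in _ + (_ + X)](eq_bigl (fun v => v \notin t)); last first.
  by move=> v; rewrite tE !inE negb_or andbC.
rewrite -big_split big1 ?addr0 //= => v; rewrite {1}tE in_setU1 negb_or => /andP[va vu].
rewrite ffunE !inE at_ orbT.
have -> : (v |: t) :\ a = v |: u.
  by apply/setP => x; rewrite !inE; case: (eqVneq x v) => // ->; rewrite va.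
have -> : orient t v = orient (a |: u) v by rewrite -tE.
have := orient_swap va vu au; have := orient2 (a |: u) v; have := orient2 u v.
set x := orient u v; set y := orient u a; set c := orient _ v; set d := orient _ a.
move=> xx cc e; have -> : d = - (x * y * c) by rewrite -[d]mul1r -xx -mulrA e; ring.
suff -> : c * (- (x * y * c) * f (v |: u)) = - (c * c) * (y * (x * f (v |: u))).
  by rewrite cc mulN1r addNr.
ring.
Qed.
End Chains.

(** * Removing cones and suspensions *)

Section Retracts.
Variables (V : finType) (K : fieldType).
Implicit Types (f g z : chain V K) (s t u : {set V}) (v a : V).
Implicit Types (X Y : {set {set V}}) (i : int).

(** The part of a chain on the star of [a], moved into the link; it inverts [cone a] on chains that
    avoid [a]. *)
Definition contraction a f : chain V K :=
  [ffun t : {set V} => if a \in t then 0 else orient K t a * f (a |: t)].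

Lemma contraction0 a : contraction a 0 = 0.
Proof. by apply/ffunP => t; rewrite !ffunE mulr0 if_same. Qed.

Lemma boundary_contraction a f :
  boundary (contraction a f) = - contraction a (boundary f).
Proof.
apply/ffunP => t; rewrite boundaryE !ffunE; case: ifPn => [at_|at_].
  by rewrite oppr0 big1 // => v vt; rewrite ffunE !inE at_ orbT mulr0.
rewrite boundaryE mulr_sumr -sumrN (bigD1 a) //= ffunE setU11 mulr0 add0r.
apply: eq_big => [v|v /andP[vt va]]; first by rewrite !inE negb_or andbC.
rewrite ffunE !inE eq_sym (negPf va) (negPf at_) /= !mulrA orient_swap //.
by rewrite mulNr setUCA.
Qed.

Lemma cone_contraction a f t :
  (cone a (contraction a f)) t = if a \in t then f t else 0.
Proof.
rewrite !ffunE; case: ifP => // at_.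
by rewrite !inE eqxx /= mulrA orient2 mul1r setD1K.
Qed.

Lemma contraction_cone a f : (forall t, a \in t -> f t = 0) ->
  contraction a (cone a f) = f.
Proof.
move=> fa; apply/ffunP => t; rewrite !ffunE; case: ifPn => [/fa//|at_].
by rewrite setU11 setU1K // mulrA orient2 mul1r.
Qed.

Lemma supported_cone X Y i a f : (forall t, t \in X -> a |: t \in Y) ->
  supported X i f -> supported Y (i + 1) (cone a f).
Proof.
move=> XY fX t; rewrite ffunE; case: ifP => [at_|_]; last by rewrite eqxx.
rewrite mulf_eq0 negb_or => /andP[_ /fX[/XY]]; rewrite setD1K // => tY.
by rewrite (cardsD1 a t) at_; lia.
Qed.

Lemma in_link X s t :
  (t \in link X s) = [&& t \in X, [disjoint s & t] & s :|: t \in X].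
Proof. by rewrite !inE. Qed.

Lemma in_link1 X a t : simplicial_complex X ->
  (t \in link X [set a]) = (a \notin t) && (a |: t \in X).
Proof.
move=> cX; rewrite in_link disjoints1; apply/and3P/andP => [[]//|[at_ atX]].
by split=> //; apply: cX atX; apply: subsetUr.
Qed.

Lemma link_complex X s : simplicial_complex X -> simplicial_complex (link X s).
Proof.
move=> cX t u ut; rewrite !in_link => /and3P[tX st stX]; apply/and3P; split.
- exact: cX tX.
- exact: disjointWr st.
- by apply: cX stX; apply: setUS.
Qed.

Lemma supported_contraction X i a f : simplicial_complex X ->
  supported X (i + 1) f -> supported (link X [set a]) i (contraction a f).
Proof.
move=> cX fX t; rewrite ffunE; case: ifPn => [_|at_]; first by rewrite eqxx.
rewrite mulf_eq0 negb_or => /andP[_ /fX[atX]]; rewrite in_link1 // at_.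
by rewrite cardsU1 at_; split=> //; lia.
Qed.

(* [s = set0] is allowed: then [X] is a cone and everything is removed. *)
Definition remove_star X s : {set {set V}} := [set t in X | ~~ (s \subset t)].

Lemma remove_star_complex X s :
  simplicial_complex X -> simplicial_complex (remove_star X s).
Proof.
move=> cX t u ut; rewrite !inE => /andP[/(cX _ _ ut)-> /=].
by apply: contra => /subset_trans; apply.
Qed.

(** The faces containing [s] pair off by adding and deleting [a], so the chains modulo those of
    [remove_star X s] are contracted by [cone a]. *)
Lemma acyclic_at_remove_star X s a i : simplicial_complex X -> a \notin s ->
  (forall t, t \in X -> s \subset t -> a |: t \in X) ->
  acyclic_at K X i <-> acyclic_at K (remove_star X s) i.
Proof.
move=> cX as_ sX; set Y := remove_star X s.
have YX : Y \subset X by apply/subsetP => t; rewrite inE => /andP[].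
(* A chain whose boundary avoids the star of [s] is moved off the star by subtracting the boundary
   of the cone over its part [f'] on the star. *)
have push j f : supported X j f -> supported Y (j - 1) (boundary f) ->
    exists2 g, supported X (j + 1) g & supported Y j (f - boundary g).
  move=> fX dfY.
  pose f' : chain V K := [ffun t : {set V} => if s \subset t then f t else 0].
  have f'X : supported [set t in X | s \subset t] j f'.
    move=> t; rewrite !ffunE; case: ifP => [st /fX|_]; last by rewrite eqxx.
    by rewrite inE st andbT.
  have gX : supported X (j + 1) (cone a f').
    by apply: supported_cone f'X => t; rewrite inE => /andP[]; apply: sX.
  exists (cone a f') => // t nz.
  have [tX tj] : t \in X /\ #|t|%:Z = j + 1.
    by apply: supportedB nz => //; apply: supported_boundary.
  split=> //; rewrite inE tX /=; apply: contraNN nz => st.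
  (* What remains at [t] is the coefficient of [cone a (boundary f')]. Since the cofaces of [t :\ a]
     all contain [s], [boundary f] may replace [boundary f'], and it vanishes there. *)
  have ft : f t = boundary (cone a f') t + cone a (boundary f') t.
    by have /ffunP/(_ t) := boundary_cone a f'; rewrite ffunE => ->; rewrite ffunE st.
  rewrite ffunE [X in _ + X]ffunE ft addrC addKr ffunE; case: ifP => // at_.
  have std : s \subset t :\ a by rewrite subsetD1 st.
  suff -> : boundary f' (t :\ a) = boundary f (t :\ a).
    rewrite mulf_eq0; apply/orP; right; apply: contraTT std => /dfY[].
    by rewrite inE => /andP[].
  rewrite !boundaryE; apply: eq_bigr => v _; rewrite ffunE ifT //.
  by apply: subset_trans std (subsetUr _ _).
split=> H z zX dz.
  have [w wX dw] := H z (supportedS YX zX) dz.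
  have [|g gX wgY] := push _ w wX; first by rewrite dw addrK.
  exists (w - boundary g) => //.
  by rewrite linearB /= boundary_boundary subr0.
have [|g gX zgY] := push _ z zX; first by rewrite dz; apply: supported0.
have [|w wY dw] := H _ zgY; first by rewrite linearB /= boundary_boundary dz subr0.
exists (w + g); first exact: supportedD (supportedS YX wY) gX.
by rewrite linearD /= dw subrK.
Qed.

Lemma acyclic_at_void i : acyclic_at K (set0 : {set {set V}}) i.
Proof.
move=> z z0 _; exists 0; first exact: supported0.
rewrite linear0; apply/ffunP => t; rewrite ffunE.
by case: (eqVneq (z t) 0) => // /z0[]; rewrite inE.
Qed.

Lemma acyclic_at_cone X a i : simplicial_complex X ->
  (forall t, t \in X -> a |: t \in X) -> acyclic_at K X i.
Proof.
move=> cX aX; apply/(@acyclic_at_remove_star _ set0 a) => //.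
- by rewrite inE.
- by move=> t /aX.
suff -> : remove_star X set0 = set0 by apply: acyclic_at_void.
by apply/setP => t; rewrite !inE sub0set andbF.
Qed.

(* The stars of the faces [F j] are removed in order of increasing [r j]; the
   condition on [X] says that each one is a cone when its turn comes. *)
Lemma acyclic_at_remove_stars (I : finType) (J : {set I}) (F : I -> {set V})
    (r : I -> nat) (apex : I -> V) i X :
  simplicial_complex X ->
  (forall j, j \in J -> apex j \notin F j) ->
  (forall j t, j \in J -> t \in X -> F j \subset t ->
     (forall k, k \in J -> (r k < r j)%N -> ~~ (F k \subset t)) ->
     apex j |: t \in X /\ forall k, k \in J -> F k \subset apex j |: t ->
       F k \subset t \/ (r j < r k)%N) ->
  acyclic_at K X i <->
  acyclic_at K [set t in X | [forall j in J, ~~ (F j \subset t)]] i.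
Proof.
have [n] := ubnP #|J|; elim: n J X => // n IH J X leJn cX aF aX.
have [->|/set0Pn[j0 Jj0]] := eqVneq J set0.
  suff -> : [set t in X | [forall j in (set0 : {set I}), ~~ (F j \subset t)]] = X.
    by [].
  apply/setP => t; rewrite inE; case: (t \in X) => //=.
  by apply/forall_inP => j; rewrite inE.
have [j jJ jmin] : exists2 j, j \in J & forall k, k \in J -> (r j <= r k)%N.
  by have [j] := arg_minnP r Jj0; exists j.
rewrite (acyclic_at_remove_star (s := F j) (a := apex j)) //; first last.
- move=> t tX st; have [|//] := aX j t jJ tX st.
  by move=> k /jmin; rewrite leqNgt => /negPf->.
- exact: aF.
rewrite (IH (J :\ j)) //.
- set A := finset _; set B := finset _; suff -> : A = B by [].
  apply/setP => t; rewrite !inE -andbA; case: (t \in X) => //=.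
  apply/andP/forall_inP => [[st /forall_inP h] k kJ|h].
    by case: (eqVneq k j) => [->//|kj]; apply: h; rewrite !inE kj.
  split; first exact: h.
  by apply/forall_inP => k /setD1P[_]; apply: h.
- by move: leJn; rewrite (cardsD1 j J) jJ add1n ltnS.
- exact: remove_star_complex.
- by move=> k /setD1P[_ /aF].
move=> k t /setD1P[kj kJ]; rewrite inE => /andP[tX jt] kt h.
have [|atX hJ] := aX k t kJ tX kt.
  move=> l lJ lk; have [->//|lj] := eqVneq l j.
  by apply: h; rewrite // !inE lj.
split; last by move=> l /setD1P[_]; apply: hJ.
(* Adding the apex of [k] cannot complete [F j]: that would require [F j \subset t] or [r k < r j],
   while [r j] is minimal. *)
rewrite inE atX /=; apply/negP => /(hJ j jJ)[|]; first by rewrite (negPf jt).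
by rewrite ltnNge jmin.
Qed.

(** [X] is the union of the acyclic [remove_star X [set a]] and the cone over the link of [a], which
    meet in the link; this is the Mayer-Vietoris argument on chains. *)
Lemma acyclic_at_suspension X a i : simplicial_complex X ->
  (forall j, acyclic_at K (remove_star X [set a]) j) ->
  acyclic_at K X i <-> acyclic_at K (link X [set a]) (i - 1).
Proof.
move=> cX acY; set Y := remove_star X [set a] in acY *.
have memY t : t \in Y = (t \in X) && (a \notin t) by rewrite inE sub1set.
have YX : Y \subset X by apply/subsetP => t; rewrite memY => /andP[].
have LY : link X [set a] \subset Y.
  by apply/subsetP => t; rewrite in_link memY disjoints1 => /and3P[-> ->].
have LX : link X [set a] \subset X by apply: subset_trans YX.
have coneX j f : supported (link X [set a]) j f -> supported X (j + 1) (cone a f).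
  by apply: supported_cone => t; rewrite in_link1 // => /andP[].
split=> H z zX dz.
  have [y yY dy] := acY _ z (supportedS LY zX) dz.
  have dh : boundary (cone a z) = z.
    rewrite -[RHS](boundary_cone a) dz.
    suff -> : cone a 0 = 0 :> chain V K by rewrite addr0.
    by apply/ffunP => t; rewrite !ffunE mulr0 if_same.
  (* Two fillings of [z], its cone and [y], differ by a cycle of [X]; contracting a chain that
     bounds this cycle fills [z] in the link, up to sign. *)
  have [||g gX dg] := H (cone a z - y).
  - rewrite -[i](subrK 1); apply: supportedB; first exact: coneX.
    exact: supportedS yY.
  - by rewrite linearB /= dh dy subrr.
  exists (- contraction a g).
    by apply/supportedN/supported_contraction; rewrite // subrK.
  rewrite linearN /= boundary_contraction opprK dg.
  have -> : contraction a (cone a z - y) = contraction a (cone a z) - contraction a y.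
    apply/ffunP => t; rewrite !ffunE; case: ifP => _; first by rewrite subr0.
    by rewrite setU11 mulrDr mulrN.
  rewrite contraction_cone; last first.
    move=> t at_; apply/eqP; apply: contraTT at_ => /zX[].
    by rewrite in_link1 // => /andP[].
  suff -> : contraction a y = 0 by rewrite subr0.
  apply/ffunP => t; rewrite !ffunE; case: ifP => // _.
  have [->|/yY[]] := eqVneq (y (a |: t)) 0; first by rewrite mulr0.
  by rewrite memY setU11 andbF.
(* Conversely [w] fills the trace of [z] on the link, and adding the boundary of [cone a w] moves
   [z] off the star of [a]. *)
have [||w wL dw] := H (contraction a z).
- by apply: supported_contraction; rewrite // subrK.
- by rewrite boundary_contraction dz contraction0 oppr0.
rewrite subrK in wL; have hX := coneX _ _ wL.
have dhw : boundary (cone a w) = w - cone a (contraction a z).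
  by rewrite -dw -[X in X - _](boundary_cone a) addrK.
have zh t : (z - cone a (contraction a z)) t = if a \in t then 0 else z t.
  by rewrite ffunE [X in _ + X]ffunE cone_contraction; case: ifP; rewrite ?subrr ?subr0.
have [||y yY dy] := acY i (z + boundary (cone a w)).
- rewrite dhw addrCA; apply: supportedD; first exact: supportedS wL.
  move=> t; rewrite zh; case: ifPn => [_|at_]; first by rewrite eqxx.
  by move=> /zX[]; rewrite memY at_ andbT.
- by rewrite linearD /= dz boundary_boundary addr0.
exists (y - cone a w); first exact/supportedB/hX/(supportedS YX).
by rewrite linearB /= dy addrK.
Qed.

End Retracts.

(** * Order-preserving embeddings *)

Section Embedding.
Variables (T T' : finType) (K : fieldType) (f : T -> T').
Hypothesis f_inj : injective f.
Hypothesis f_mono : forall x y,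
  (enum_rank (f x) < enum_rank (f y))%N = (enum_rank x < enum_rank y)%N.
Implicit Types (t : {set T}) (y : {set T'}) (X : {set {set T}}).

Definition image_complex X : {set {set T'}} := [set f @: (t : {set T}) | t in X].

Lemma preimset_imsetK t : f @^-1: (f @: t) = t.
Proof. by apply/setP => x; rewrite inE mem_imset. Qed.

Lemma mem_image_complex X t : (f @: t \in image_complex X) = (t \in X).
Proof. exact/mem_imset/imset_inj. Qed.

Lemma image_complex_complex X :
  simplicial_complex X -> simplicial_complex (image_complex X).
Proof.
move=> cX y0 y yt /imsetP[t tX e]; rewrite {y0}e in yt.
have -> : y = f @: (f @^-1: y).
  apply/setP => w; apply/idP/imsetP => [wy|[x]]; last by rewrite inE => ? ->.
  by have /imsetP[x xt e] := subsetP yt w wy; exists x => //; rewrite inE -e.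
rewrite mem_image_complex; apply: cX tX.
by rewrite -[t]preimset_imsetK; apply: preimsetS.
Qed.

Lemma vertex_pos_imset t v : vertex_pos (f @: t) (f v) = vertex_pos t v.
Proof.
rewrite /vertex_pos -(card_imset _ f_inj); apply: eq_card => w; rewrite !inE.
apply/andP/imsetP => [[/imsetP[x xt ->]]|[x]].
  by rewrite f_mono => xv; exists x; rewrite // inE xt.
by rewrite inE => /andP[xt xv] ->; rewrite mem_imset // f_mono.
Qed.

Definition pull (g : chain T' K) : chain T K := [ffun t : {set T} => g (f @: t)].

(** The test recognises the subsets of the range of [f]; elsewhere the chain is extended by zero. *)
Definition push (g : chain T K) : chain T' K :=
  [ffun y : {set T'} => if y == f @: (f @^-1: y) then g (f @^-1: y) else 0].

Lemma pushK g : pull (push g) = g.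
Proof. by apply/ffunP => t; rewrite !ffunE preimset_imsetK eqxx. Qed.

Lemma pull_inj X i g h : supported (image_complex X) i g ->
  supported (image_complex X) i h -> pull g = pull h -> g = h.
Proof.
move=> gX hX e; have e0 y : (g - h) y = 0.
  have [//|/(supportedB gX hX)[/imsetP[t tX ->] _]] := eqVneq ((g - h) y) 0.
  by have /ffunP/(_ t) := e; rewrite !ffunE => ->; rewrite subrr.
by apply/ffunP => y; have /eqP := e0 y; rewrite !ffunE subr_eq0 => /eqP.
Qed.

(** The support matters: on other chains the boundary over [T'] also involves vertices outside the
    range of [f]. *)
Lemma boundary_pull X i g : supported (image_complex X) i g ->
  boundary (pull g) = pull (boundary g).
Proof.
move=> gX; apply/ffunP => t; rewrite ffunE !boundaryE.
rewrite [RHS](bigID (mem (f @: ~: t))) /= [X in _ + X]big1 ?addr0; last first.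
  move=> w /andP[wt wct]; have [->|/gX[/imsetP[u _ e] _]] := eqVneq (g (w |: f @: t)) 0.
    by rewrite mulr0.
  have : w \in f @: u by rewrite -e setU11.
  case/imsetP=> x xu ex; move: wt wct.
  by rewrite ex !mem_imset // inE negbK => /negPf->.
rewrite (eq_bigl (mem (f @: ~: t))); last first.
  move=> w /=; apply: andb_idl => /imsetP[x]; rewrite inE => xt ->.
  by rewrite mem_imset.
rewrite big_imset /=; last by move=> x x' _ _; apply: f_inj.
apply: eq_big => v; rewrite ?inE // => vt.
by rewrite ffunE imsetU1 /orient vertex_pos_imset.
Qed.

Lemma supported_pull X i g :
  supported (image_complex X) i g -> supported X i (pull g).
Proof. by move=> gX t; rewrite ffunE => /gX[]; rewrite mem_image_complex card_imset. Qed.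

Lemma supported_push X i g :
  supported X i g -> supported (image_complex X) i (push g).
Proof.
move=> gX y; rewrite ffunE; case: ifP => [/eqP e /gX[yX yi]|_]; last by rewrite eqxx.
by rewrite e mem_image_complex card_imset.
Qed.

Lemma acyclic_at_image X i : simplicial_complex X ->
  acyclic_at K (image_complex X) i <-> acyclic_at K X i.
Proof.
move=> /image_complex_complex cX; split=> H z zX dz.
  have dpz : boundary (push z) = 0.
    have bX := supported_push zX; rewrite -[i](subrK 1) in bX.
    apply: pull_inj (supported_boundary cX bX) (@supported0 _ _ _ _) _.
    rewrite -(boundary_pull (supported_push zX)) pushK dz.
    by apply/ffunP => t; rewrite !ffunE.
  have [w wX dw] := H _ (supported_push zX) dpz.
  exists (pull w); first exact: supported_pull.
  by rewrite (boundary_pull wX) dw pushK.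
have [|w wX dw] := H _ (supported_pull zX).
  by rewrite (boundary_pull zX) dz; apply/ffunP => t; rewrite !ffunE.
exists (push w); first exact: supported_push.
apply: pull_inj (supported_boundary cX (supported_push wX)) zX _.
by rewrite -(boundary_pull (supported_push wX)) pushK.
Qed.

End Embedding.

(** * Vertex order on a disjoint union *)

Lemma enum_rank_index (T : finType) (x : T) : enum_rank x = index x (enum T) :> nat.
Proof. by rewrite -{2}[x]enum_rankK (enum_val_nth x) index_uniq ?enum_uniq // -cardE. Qed.

(** Each summand keeps its order, so both injections qualify as order-preserving embeddings. *)
Lemma enum_sum (T1 T2 : finType) :
  enum {: T1 + T2} = map inl (enum T1) ++ map inr (enum T2).
Proof. by rewrite !enumT [in LHS]unlock. Qed.

Lemma inl_inj (T1 T2 : Type) : injective (@inl T1 T2).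
Proof. by move=> ? ? []. Qed.

Lemma inr_inj (T1 T2 : Type) : injective (@inr T1 T2).
Proof. by move=> ? ? []. Qed.

Lemma enum_rank_inl (T1 T2 : finType) (x y : T1) :
  (enum_rank (inl x : T1 + T2) < enum_rank (inl y : T1 + T2))%N =
  (enum_rank x < enum_rank y)%N.
Proof.
rewrite !enum_rank_index enum_sum !index_cat !map_f ?mem_enum //.
by rewrite !(index_map (@inl_inj _ _)).
Qed.

Lemma enum_rank_inr (T1 T2 : finType) (x y : T2) :
  (enum_rank (inr x : T1 + T2) < enum_rank (inr y : T1 + T2))%N =
  (enum_rank x < enum_rank y)%N.
Proof.
rewrite !enum_rank_index enum_sum !index_cat.
have notl z : (inr z : T1 + T2) \in map inl (enum T1) = false.
  by apply/negP => /mapP[].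
by rewrite !notl ltn_add2l !(index_map (@inr_inj _ _)).
Qed.

(** * Flags *)

Section OrderComplex.
Variable (V : finType).
Implicit Types (s t u : {set V}) (c P D : {set {set V}}).

Definition comparable_sets s t := (s \subset t) || (t \subset s).

(** Convertible with [barycentric D] when [P] is [D :\ set0]; results are applied to subdivisions
    through this conversion. *)
Definition order_complex P : {set {set {set V}}} :=
  [set c : {set {set V}} | (c \subset P)
    && [forall s in c, forall t in c, comparable_sets s t]].

Lemma order_complexP P c : reflect
  ((forall s, s \in c -> s \in P) /\
   forall s t, s \in c -> t \in c -> comparable_sets s t)
  (c \in order_complex P).
Proof.
rewrite inE; apply: (iffP andP) => [[/subsetP cP /forall_inP h]|[cP h]].
  by split=> // s t sc; apply/forall_inP/h.
split; first exact/subsetP.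
by apply/forall_inP => s sc; apply/forall_inP => t; apply: h.
Qed.

Lemma order_complex_complex P : simplicial_complex (order_complex P).
Proof.
move=> c d /subsetP dc /order_complexP[cP cc].
by apply/order_complexP; split=> [s /dc/cP|s t /dc sc /dc] //; apply: cc.
Qed.

Lemma comparable_setsC s t : comparable_sets s t = comparable_sets t s.
Proof. exact: orbC. Qed.

Lemma comparable_setsxx s : comparable_sets s s.
Proof. by rewrite /comparable_sets subxx. Qed.

Lemma order_complexU1 P c s : c \in order_complex P -> s \in P ->
  (forall t, t \in c -> comparable_sets s t) -> s |: c \in order_complex P.
Proof.
move=> /order_complexP[cP cc] sP sc; apply/order_complexP; split.
  by move=> t /setU1P[->|/cP].
move=> t u /setU1P[->|tc] /setU1P[->|uc].
- exact: comparable_setsxx.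
- exact: sc.
- by rewrite comparable_setsC sc.
- exact: cc.
Qed.

End OrderComplex.

(* The mapping cylinder [cyl] joins a face [A] of the link to a flag of
   faces containing it; it retracts onto the link and onto the flags. *)
Section Cylinder.
Variables (V : finType) (K : fieldType) (D : {set {set V}}) (s : {set V}).
Hypotheses (cD : simplicial_complex D) (sD : s \in D).
Implicit Types (t u A : {set V}) (x : {set V + {set V}}).

Let P := [set t in D | s \proper t].

Definition cyl : {set {set V + {set V}}} :=
  [set x : {set V + {set V}} | [&& inl @^-1: x \in link D s,
     inr @^-1: x \in order_complex P
   & [forall t in inr @^-1: x, inl @^-1: x \subset t]]].

Lemma cylP x : reflect
  [/\ inl @^-1: x \in link D s, inr @^-1: x \in order_complex P
    & forall t v, inr t \in x -> inl v \in x -> v \in t]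
  (x \in cyl).
Proof.
rewrite [X in reflect _ X]in_set; apply: (iffP and3P) => -[xl xr h]; split=> //.
  by move=> t v tx vx; move/forall_inP/(_ t): h; rewrite inE => /(_ tx)/subsetP->; rewrite // inE.
by apply/forall_inP => t; rewrite inE => tx; apply/subsetP => v; rewrite inE; apply: h.
Qed.

Lemma cyl_complex : simplicial_complex cyl.
Proof.
move=> x y yx /cylP[xl xr h]; apply/cylP; split.
- by apply: link_complex xl => //; apply: preimsetS.
- by apply: order_complex_complex xr => //; apply: preimsetS.
- by move=> t v /(subsetP yx) tx /(subsetP yx); apply: h.
Qed.

(** Flag vertices are removed by increasing size. At its turn [t] is contained in all flag members
    of the face, so a vertex of [t :\: s] can join the link part and serves as apex. *)
Lemma acyclic_at_cyl_link i : acyclic_at K cyl i <-> acyclic_at K (link D s) i.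
Proof.
(* The value [inr t] is a default, never reached for [t] in [P]. *)
pose apex t : V + {set V} := if [pick v in t :\: s] is Some v then inl v else inr t.
have apexP t : t \in P -> exists2 v, v \in t :\: s & apex t = inl v.
  rewrite inE => /andP[_ /properP[_ [v vt vs]]]; rewrite /apex.
  case: pickP => [w wts|/(_ v)]; first by exists w.
  by rewrite !inE vs vt.
rewrite (@acyclic_at_remove_stars _ K _ P (fun t => [set inr t])
  (fun t => #|t|) apex); first 1 last.
- exact: cyl_complex.
- by move=> t /apexP[v _ ->]; rewrite inE.
- move=> t x tP xc; rewrite sub1set => tx tmin.
  have [v /setDP[vt vs] ->] := apexP t tP; split; last first.
    by move=> u uP; rewrite !sub1set !inE; left.
  have /cylP[xl xr h] := xc.
  have vmem u : inr u \in x -> v \in u.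
    move=> ux; have /order_complexP[xP xcc] := xr.
    have := xcc t u; rewrite !inE => /(_ tx ux)/orP[/subsetP->//|ut].
    have := tmin u; rewrite sub1set ux => /(_ (xP u _)).
    rewrite inE ux => /(_ isT); case: ltnP => [_ /(_ isT)//|tu _].
    by have /eqP-> : u == t by rewrite eqEcard ut.
  apply/cylP; split.
  + have -> : inl @^-1: (inl v |: x) = v |: inl @^-1: x.
      by apply/setP => w; rewrite !inE.
    have sub : s :|: (v |: inl @^-1: x) \subset t.
      move: tP; rewrite inE => /andP[tD /proper_sub st].
      rewrite subUset st subUset sub1set vt /=; apply/subsetP => w.
      by rewrite inE; apply: h.
    have tD : t \in D by move: tP; rewrite inE => /andP[].
    move: xl; rewrite !in_link => /and3P[_ ds _].
    rewrite !(cD _ tD) //=; last by apply: subset_trans sub; apply: subsetUr.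
    by rewrite andbT -setI_eq0 setIUr setU_eq0 !setI_eq0 ds disjoint_sym disjoints1 vs.
  + have -> // : inr @^-1: (inl v |: x) = inr @^-1: x.
    by apply/setP => w; rewrite !inE.
  + by move=> u w; rewrite !inE /= => ux /orP[/eqP[->]|]; [apply: vmem|apply: h].
rewrite -(acyclic_at_image K (@inl_inj V {set V}) (@enum_rank_inl _ _)); last exact: link_complex.
set A := finset _; set B := image_complex _ _; suff -> : A = B by [].
apply/setP => x; rewrite inE; apply/andP/imsetP => [[/cylP[xl xr h] /forall_inP n]|[t tL ->]].
  exists (inl @^-1: x) => //; apply/setP => -[v|t].
    by rewrite mem_imset ?inE //; apply: inl_inj.
  apply/idP/imsetP => [tx|[//]].
  have /order_complexP[/(_ t) xP _] := xr; rewrite inE in xP.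
  by have := n t (xP tx); rewrite sub1set tx.
have e : inl @^-1: [set (inl v : V + {set V}) | v in t] = t.
  exact: (preimset_imsetK (@inl_inj _ _)).
have n u : (inr u : V + {set V}) \in [set inl v | v in t] = false by apply/imsetP => -[].
split; last by apply/forall_inP => u _; rewrite sub1set n.
apply/cylP; split; first by rewrite e.
  by apply/order_complexP; split=> [u|u w]; rewrite inE n.
by move=> u v; rewrite n.
Qed.

(** Nonempty link faces [A] are removed, the largest first. At its turn [A] is the whole link part,
    and every flag member contains [s :|: A], which therefore extends the flag and serves as
    apex. *)
Lemma acyclic_at_cyl_order i : acyclic_at K cyl i <-> acyclic_at K (order_complex P) i.
Proof.
rewrite (@acyclic_at_remove_stars _ K _ (link D s :\ set0)
  (fun A => inl @: A) (fun A => #|~: A|) (fun A => inr (s :|: A))); first 1 last.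
- exact: cyl_complex.
- by move=> A _; apply/imsetP => -[].
- move=> A x /setD1P[A0 AL] xc Ax Amax.
  have /cylP[xl xr h] := xc.
  have xA : inl @^-1: x = A.
    have sub : A \subset inl @^-1: x.
      by apply/subsetP => v vA; rewrite inE (subsetP Ax) // imset_f.
    apply/eqP; rewrite eq_sym eqEsubset sub /=; apply: contraT => nsub.
    have pr : A \proper inl @^-1: x by rewrite properE sub.
    have := Amax (inl @^-1: x); rewrite in_setD1 xl andbT.
    have [x0|_ /(_ isT)] := eqVneq (inl @^-1: x) set0.
      by move: nsub; rewrite x0 sub0set.
    rewrite proper_card; last by rewrite properC.
    move=> /(_ isT)/negP[]; apply/subsetP => _ /imsetP[v vx ->].
    by rewrite inE in vx.
  split; last first.
    move=> B _ /subsetP BsA; left; apply/subsetP => _ /imsetP[v vB ->].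
    by have := BsA (inl v) (imset_f _ vB); rewrite !inE.
  move: AL; rewrite in_link => /and3P[AD sA sAD].
  have sAP : s :|: A \in P.
    rewrite inE sAD properE subsetUl subUset subxx /=.
    apply: contra A0 => As; rewrite -subset0 -(setIidPr As); move: sA.
    by rewrite -setI_eq0 => /eqP->.
  have [/= xP xcc] := order_complexP _ _ xr.
  have sAx t : inr t \in x -> s :|: A \subset t.
    move=> tx; have := xP t; rewrite !inE => /(_ tx)/andP[_ /proper_sub st].
    by rewrite subUset st -xA; apply/subsetP => v; rewrite inE; apply: h.
  apply/cylP; split.
  + have -> // : inl @^-1: (inr (s :|: A) |: x) = inl @^-1: x.
    by apply/setP => w; rewrite !inE.
  + have -> : inr @^-1: (inr (s :|: A) |: x) = (s :|: A) |: inr @^-1: x.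
      by apply/setP => w; rewrite !inE.
    apply: order_complexU1 => // t; rewrite inE => /sAx sAt.
    by rewrite /comparable_sets sAt.
  + move=> t v; rewrite !inE /= => /orP[/eqP[->]|tx] vx; last exact: h tx vx.
    by rewrite inE -xA inE vx orbT.
rewrite -(acyclic_at_image K (@inr_inj V {set V}) (@enum_rank_inr _ _)); last exact: order_complex_complex.
set A := finset _; set B := image_complex _ _; suff -> : A = B by [].
apply/setP => x; rewrite inE; apply/andP/imsetP => [[/cylP[xl xr h] /forall_inP n]|[c cO ->]].
  exists (inr @^-1: x) => //; apply/setP => -[v|t]; last first.
    by rewrite mem_imset ?inE //; apply: inr_inj.
  apply/idP/imsetP => [vx|[//]].
  have := n (inl @^-1: x); rewrite in_setD1 xl andbT => /(_ _)/negP[].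
    by apply/set0Pn; exists v; rewrite inE.
  by apply/subsetP => _ /imsetP[w wx ->]; rewrite inE in wx.
have e : inr @^-1: [set (inr t : V + {set V}) | t in c] = c.
  exact: (preimset_imsetK (@inr_inj _ _)).
have n v : (inl v : V + {set V}) \in [set inr t | t in c] = false by apply/imsetP => -[].
split; last first.
  apply/forall_inP => t /setD1P[/set0Pn[v vt] _]; apply/negP => /subsetP/(_ (inl v)).
  by rewrite n imset_f // => /(_ isT).
apply/cylP; split; last by move=> t v _; rewrite n.
  have -> : inl @^-1: [set (inr t : V + {set V}) | t in c] = set0.
    by apply/setP => v; rewrite inE n inE.
  by rewrite in_link (cD (sub0set s) sD) setU0 sD -setI_eq0 setI0 eqxx.
by rewrite e.
Qed.
End Cylinder.

(** * Links in the subdivision *)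

Section Links.
Variable V : finType.
Implicit Types (s t u : {set V}) (c P D : {set {set V}}).

Lemma link_link_vertex D s a : simplicial_complex D -> a \notin s ->
  link (link D s) [set a] = link D (a |: s).
Proof.
move=> cD as_; apply/setP => t; rewrite in_link1; last exact: link_complex.
rewrite !in_link -!setI_eq0 setIUl setIUr !setU_eq0 !setI_eq0.
rewrite disjoint_sym !disjoints1 as_ setUCA -setUA /=.
apply/and4P/and3P => [[at_ tD st stD]|[tD /andP[at_ st] stD]].
  by split; rewrite ?at_ //; apply: cD tD; apply: subsetUr.
split=> //; apply: cD stD; apply: setUS; apply: subsetUr.
Qed.

Lemma link_order_complex P c : c \in order_complex P ->
  link (order_complex P) c =
  order_complex [set s in P | (s \notin c) && [forall t in c, comparable_sets s t]].
Proof.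
move=> /order_complexP[cP cc]; apply/setP => d; rewrite in_link.
apply/and3P/order_complexP => [[/order_complexP[dP dd] cd /order_complexP[_ cdcd]]|[dP dd]].
  split=> // s sd; rewrite inE dP //= (disjointFl cd sd) /=.
  by apply/forall_inP => t tc; apply: cdcd; rewrite inE ?sd ?tc ?orbT.
have dPP s : s \in d -> s \in P by move=> /dP; rewrite inE => /andP[].
have dc s t : s \in d -> t \in c -> comparable_sets s t.
  by move=> /dP; rewrite inE => /and3P[_ _ /forall_inP]; apply.
split; first exact/order_complexP.
  rewrite -setI_eq0; apply/eqP/setP => s; rewrite !inE andbC.
  by apply/negP => /andP[/dP]; rewrite inE => /and3P[_ /negPf->].
apply/order_complexP; split=> [s /setUP[/cP|/dPP]//|s t /setUP[sc|sd] /setUP[tc|td]].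
- exact: cc.
- by rewrite comparable_setsC; apply: dc.
- exact: dc.
- exact: dd.
Qed.

Lemma remove_star_order_complex P s :
  remove_star (order_complex P) [set s] = order_complex (P :\ s).
Proof.
apply/setP => c; rewrite inE sub1set; apply/andP/order_complexP => [[/order_complexP[cP cc] sc]|[cP cc]].
  split=> // t tc; rewrite !inE cP // andbT.
  by apply: contraNneq sc => <-.
split; last by apply/negP => /cP; rewrite !inE eqxx.
by apply/order_complexP; split=> // t /cP/setD1P[].
Qed.

Lemma sub_cover c s : s \in c -> s \subset cover c.
Proof. exact: bigcup_sup. Qed.

(** A member of maximal cardinality contains all members, being comparable with them. *)
Lemma cover_order_complex P c : c \in order_complex P -> c != set0 -> cover c \in c.
Proof.
move=> /order_complexP[_ cc] /set0Pn[s0 s0c].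
have [s sc smax] : exists2 s, s \in c & forall t, t \in c -> (#|t| <= #|s|)%N.
  by have [s] := arg_maxnP (fun s : {set V} => #|s|) s0c; exists s.
suff -> : cover c = s by [].
apply/eqP; rewrite eqEsubset sub_cover // andbT; apply/bigcupsP => t tc.
have /orP[//|st] := cc t s tc sc.
by have /eqP-> : s == t by rewrite eqEcard st smax.
Qed.

Lemma order_complexD1 P c s : c \in order_complex P -> c :\ s \in order_complex P.
Proof. by apply: order_complex_complex; apply: subD1set. Qed.

(** The new union is the next member down, or empty for a one-member flag, where [set0 \notin P]
    makes the inclusion strict. *)
Lemma cover_setD1_cover_proper P c : set0 \notin P -> c \in order_complex P ->
  c != set0 -> cover (c :\ cover c) \proper cover c.
Proof.
move=> P0 cO c0; have mc := cover_order_complex cO c0.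
have [cm0|cm0] := eqVneq (c :\ cover c) set0.
  rewrite cm0 /cover big_set0 proper0; apply: contraNneq P0 => m0.
  by have [cP _] := order_complexP _ _ cO; rewrite -m0; apply: cP.
have /setD1P[ne inc] := cover_order_complex (order_complexD1 _ cO) cm0.
by rewrite properEneq ne sub_cover.
Qed.

(** Deleting the top member shrinks the union strictly. Equality holds for the full flags, with
    members of sizes 1 to [#|c|]. *)
Lemma card_order_complex P c : set0 \notin P -> c \in order_complex P ->
  (#|c| <= #|cover c|)%N.
Proof.
move=> P0; have [n] := ubnP #|c|; elim: n c => // n IH c lecn cO.
have [->|c0] := eqVneq c set0; first by rewrite cards0.
have lt := proper_card (cover_setD1_cover_proper P0 cO c0).
have cE : #|c| = #|c :\ cover c|.+1.
  by rewrite (cardsD1 (cover c) c) (cover_order_complex cO).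
rewrite cE (leq_ltn_trans _ lt) // IH //; first by rewrite -ltnS -cE.
exact: order_complexD1.
Qed.

(** The search runs down from the top member; [lo = set0] covers a gap below the smallest one. *)
Lemma order_complex_gap P c : set0 \notin P -> c \in order_complex P ->
  (#|c| < #|cover c|)%N ->
  exists lo hi : {set V}, [/\ hi \in c, lo = set0 \/ lo \in c, lo \subset hi,
    (#|lo|.+1 < #|hi|)%N & forall s, s \in c -> s \subset lo \/ hi \subset s].
Proof.
move=> P0; have [n] := ubnP #|c|; elim: n c => // n IH c lecn cO ltc.
have c0 : c != set0 by apply: contraTneq ltc => ->; rewrite /cover big_set0 !cards0.
have mc := cover_order_complex cO c0.
have pr := cover_setD1_cover_proper P0 cO c0.
set m := cover c in mc pr ltc *; set c' := c :\ m in pr *.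
have c'O : c' \in order_complex P by apply: order_complexD1.
case: (ltnP #|cover c'|.+1 #|m|) => [gap|nogap].
  exists (cover c'), m; split=> //; last 1 first.
  - move=> s sc; have [->|sm] := eqVneq s m; first by right.
    by left; apply: sub_cover; rewrite !inE sm.
  - have [->|c'0] := eqVneq c' set0; first by left; rewrite /cover big_set0.
    by right; have /setD1P[] := cover_order_complex c'O c'0.
  - exact: proper_sub.
(* Without a gap at the top, deleting [m] lowers both sizes by exactly one, so the strict inequality
   persists. *)
have cc' : #|c| = #|c'|.+1 by rewrite (cardsD1 m c) mc.
have [||lo [hi [hic lo0 lohi gap h]]] := IH c' _ c'O; try lia.
exists lo, hi; split=> //; first by case/setD1P: hic.
  by case: lo0 => [|/setD1P[]]; [left|right].
move=> s sc; have [->|sm] := eqVneq s m; last by apply: h; rewrite !inE sm.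
by right; apply: sub_cover; case/setD1P: hic.
Qed.

End Links.

(** * Homology of links in the subdivision *)

Section Subdivision.
Variables (V : finType) (K : fieldType).
Implicit Types (s t u : {set V}) (c P D : {set {set V}}).

(* Below [hi] and above [lo], adding [v] retracts the flags avoiding
   [hi :\ v] onto the cone with apex [v |: lo]. *)
Lemma acyclic_at_order_complex_gap P (lo hi : {set V}) v i :
  v \in hi -> v \notin lo -> lo \subset hi -> (#|lo|.+1 < #|hi|)%N ->
  (forall s, s \in P -> [\/ s \subset lo, hi \subset s | lo \subset s /\ s \subset hi]) ->
  (forall s, lo \proper s -> s \proper hi -> s != hi :\ v -> s \in P) ->
  hi :\ v \notin P ->
  acyclic_at K (order_complex P) i.
Proof.
move=> vhi vlo lohi gap P3 inP hiP.
(* The intermediate members avoiding [v], to be removed from the largest down, [s] with apex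
   [v |: s]. *)
pose bad := [set s in P | [&& lo \proper s, s \proper hi & v \notin s]].
(* A member outside [bad] that is comparable with [t] stays comparable with [v |: t]. *)
have midP s t : s \in P -> s \notin bad -> lo \subset t -> t \subset hi ->
    (s \subset v |: t) || (v |: t \subset s) || ~~ comparable_sets t s.
  move=> sP sbad lot thi; case: (P3 s sP) => [slo|his|[los shi]].
  - by rewrite (subset_trans (subset_trans slo lot) (subsetUr _ _)).
  - by rewrite [X in _ || X || _]subUset sub1set (subsetP his) // (subset_trans thi) ?orbT.
  case: (boolP (v \in s)) => vs.
    rewrite [X in _ || X || _]subUset sub1set vs /= /comparable_sets.
    case: (boolP (t \subset s)); rewrite ?orbT //= => _.
    case: (boolP (s \subset t)) => st; rewrite ?orbT //.
    by rewrite (subset_trans st (subsetUr _ _)).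
  suff -> : s = lo by rewrite (subset_trans lot (subsetUr _ _)).
  apply/eqP; rewrite eqEsubset los andbT; apply: contraR sbad => slo.
  rewrite inE sP properE los slo properE shi vs /= andbT.
  by apply: contra vs => /subsetP; apply.
rewrite (@acyclic_at_remove_stars _ K _ bad (fun s => [set s]) (fun s => #|~: s|)
  (fun s => v |: s)); first 1 last.
- exact: order_complex_complex.
- move=> s; rewrite !inE => /and4P[_ _ _ vs].
  by apply: contraNneq vs => <-; rewrite setU11.
- move=> s c sbad cO; rewrite sub1set => sc smax.
  have /and4P[sP los shi vs] :
      [&& s \in P, lo \proper s, s \proper hi & v \notin s].
    by move: sbad; rewrite inE.
  have vsP : v |: s \in P.
    apply: inP.
    - exact: proper_sub_trans los (subsetUr _ _).
    (* Only [s = hi :\ v] would give [v |: s = hi], and that face is not in [P]. *)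
    - rewrite properE subUset sub1set vhi proper_sub //=.
      apply: contra hiP => hivs; suff -> : hi :\ v = s by [].
      apply/eqP; rewrite eqEsubset subDset hivs /= subsetD1 vs.
      by rewrite proper_sub.
    - by apply: contraTneq (setU11 v s) => ->; rewrite !inE eqxx.
  split; last first.
    move=> t tbad; rewrite !sub1set => /setU1P[e|]; last by left.
    by move: tbad; rewrite e inE setU11 !andbF.
  apply: order_complexU1 => // t tc.
  have [cP cc] := order_complexP _ _ cO.
  have cst := cc s t sc tc.
  case: (boolP (t \in bad)) => tbad; last first.
    have := midP t s (cP _ tc) tbad (proper_sub los) (proper_sub shi).
    by rewrite cst orbF orbC.
  have := smax t tbad; rewrite sub1set tc => nlt.
  have ts : t \subset s.
    case/orP: cst => // st; have [->//|ne] := eqVneq s t.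
    suff /nlt : (#|~: t| < #|~: s|)%N by [].
    by rewrite proper_card // properC properEneq ne.
  by rewrite /comparable_sets (subset_trans ts (subsetUr _ _)) orbT.
(* Every remaining member is comparable with [v |: lo], by [midP] at [lo] in the intermediate
   range. *)
apply: (@acyclic_at_cone _ _ _ (v |: lo)).
  move=> c d dc; rewrite in_set => /andP[cO /forall_inP h].
  rewrite in_set (order_complex_complex dc) //=.
  by apply/forall_inP => s /h; apply: contra => /subset_trans; apply.
move=> c; rewrite in_set => /andP[cO /forall_inP h].
have [cP cc] := order_complexP _ _ cO.
have nbad s : s \in c -> s \notin bad by apply: contraL => /h; rewrite sub1set.
have vloP : v |: lo \in P.
  apply: inP.
  - by rewrite properE subsetUr subUset sub1set (negPf vlo).
  - rewrite properE subUset sub1set vhi lohi; apply: contraL gap => /subset_leq_card.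
    by rewrite cardsU1 vlo -leqNgt.
  - by apply: contraTneq (setU11 v lo) => ->; rewrite !inE eqxx.
rewrite in_set order_complexU1 //=; last first.
  move=> t tc; have := midP t lo (cP _ tc) (nbad _ tc) (subxx _) lohi.
  case: (P3 t (cP _ tc)) => [slo|his|[los _]].
  - by rewrite /comparable_sets (subset_trans slo (subsetUr _ _)) orbT.
  - by rewrite /comparable_sets subUset sub1set (subsetP his) // (subset_trans lohi).
  by rewrite /comparable_sets los orbF orbC.
apply/forall_inP => s sbad; rewrite sub1set; apply/setU1P => -[e|/nbad/negP//].
by move: sbad; rewrite e inE setU11 !andbF.
Qed.

Lemma set0_notin_D1 D : set0 \notin D :\ set0.
Proof. by rewrite !inE eqxx. Qed.

Lemma cover_barycentric D c : simplicial_complex D -> set0 \in D ->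
  c \in barycentric D -> cover c \in D.
Proof.
move=> cD D0 cB; have [->|c0] := eqVneq c set0; first by rewrite /cover big_set0.
have [cP _] := order_complexP _ _ cB.
by have /cP/setD1P[] := cover_order_complex cB c0.
Qed.

(** Induction on the number of sizes that the flag misses: inserting a face into a gap lowers this
    number by one and, by suspension, the homological degree by one. *)
Lemma acyclic_at_link_barycentric D c i : simplicial_complex D -> set0 \in D ->
  c \in barycentric D ->
  acyclic_at K (link (barycentric D) c) i <->
  acyclic_at K (link D (cover c)) (i - (#|cover c|%:Z - #|c|%:Z)).
Proof.
move=> cD D0; have [n] := ubnP (#|cover c| - #|c|); elim: n c i => // n IH c i lecn cB.
have lec := card_order_complex (set0_notin_D1 D) cB.
have [cP cc] := order_complexP _ _ cB.
have coverD := cover_barycentric cD D0 cB.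
case: ltngtP lec => // [lec|eqc] _; last first.
  (* For a full flag the link consists of the flags strictly above [cover c], and the cylinder
     compares it with the link of [cover c]. *)
  rewrite eqc subrr subr0 -(acyclic_at_cyl_link K (cover c) cD).
  rewrite (acyclic_at_cyl_order K cD coverD) link_order_complex //.
  set A := finset _; set B := finset _; suff -> : A = B by [].
  apply/setP => s; rewrite !inE.
  apply/idP/andP => [/and3P[/andP[s0 sD] sc /forall_inP h]|[sD pr]].
    split=> //.
    (* A new face comparable with a full flag cannot fit below its top: the longer flag would have
       more members than its union has vertices. *)
    have scB : s |: c \in order_complex (D :\ set0) by apply: order_complexU1; rewrite // !inE s0.
    have := card_order_complex (set0_notin_D1 D) scB.
    rewrite cardsU1 sc /cover big_setU1 //= -/(cover c) => lecs.
    rewrite properE; apply/andP; split; last first.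
      by apply: contraL lecs => /setUidPr->; rewrite eqc add1n ltnn.
    have [->|c0] := eqVneq c set0; first by rewrite /cover big_set0 sub0set.
    have /orP[sub|//] := h _ (cover_order_complex cB c0).
    by move: lecs; rewrite (setUidPr sub) eqc add1n ltnn.
  have sc : s \notin c by apply: contraL pr => /sub_cover ss; rewrite properE ss andbF.
  rewrite sD sc andbT; apply/andP; split.
    by apply: contraL pr => /eqP->; rewrite properE sub0set andbF.
  apply/forall_inP => t /sub_cover tc; rewrite comparable_setsC /comparable_sets.
  by rewrite (subset_trans tc) // proper_sub.
have [lo [hi [hic lo0 lohi gap h]]] := order_complex_gap (set0_notin_D1 D) cB lec.
have [v vhi vlo] : exists2 v, v \in hi & v \notin lo.
  apply/subsetPn; apply: contraL gap => /subset_leq_card; lia.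
have /setD1P[_ hiD] := cP _ hic.
(* The face to insert; the gap keeps it strictly above [lo]. *)
pose t0 := hi :\ v.
have t0hi : t0 \proper hi by apply: properD1.
have lot0 : lo \proper t0.
  rewrite properE subsetD1 lohi vlo /=; apply: contraL gap => /subset_leq_card.
  by rewrite -leqNgt (cardsD1 v hi) vhi add1n ltnS.
have t0P : t0 \in D :\ set0.
  rewrite !inE (cD hi) ?andbT ?proper_sub //.
  by apply: contraTneq lot0 => ->; rewrite properE sub0set andbF.
have notc s : lo \proper s -> s \proper hi -> s \notin c.
  move=> los shi; apply/negP => /h[slo|his].
    by move: los; rewrite properE slo andbF.
  by move: shi; rewrite properE his andbF.
have cmp s t : lo \proper s -> s \proper hi -> t \in c -> comparable_sets s t.
  move=> /proper_sub los /proper_sub shi /h[tlo|hit]; rewrite /comparable_sets.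
    by rewrite (subset_trans tlo los) orbT.
  by rewrite (subset_trans shi hit).
have t0c := notc _ lot0 t0hi.
have c1B : t0 |: c \in barycentric D.
  by apply: order_complexU1 => // t; apply: cmp.
have cB' : simplicial_complex (barycentric D) by apply: order_complex_complex.
(* Without the vertex [t0] the link is acyclic by the gap lemma, and the link of [t0] inside it is
   the link of [t0 |: c]. *)
rewrite (@acyclic_at_suspension _ _ _ t0); first last.
- move=> j; rewrite link_order_complex // remove_star_order_complex.
  apply: (acyclic_at_order_complex_gap (lo := lo) (hi := hi) (v := v)) => //.
  + move=> s /setD1P[_]; rewrite inE => /and3P[_ _ /forall_inP cs].
    have /orP[shi|] := cs _ hic; last by constructor 2.
    case: lo0 => [->|/cs/orP[slo|los]]; [|by constructor 1|].
      by constructor 3; rewrite sub0set.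
    by constructor 3.
  + move=> s los shi st0; rewrite !inE st0 (cD hi) ?proper_sub // notc //= andbT.
    apply/andP; split; first by apply: contraTneq los => ->; rewrite properE sub0set andbF.
    by apply/forall_inP => t; apply: cmp.
  + by rewrite !inE eqxx.
- exact: link_complex.
have cov1 : cover (t0 |: c) = cover c.
  rewrite /cover big_setU1 //=; apply/setUidPr.
  by apply: subset_trans (proper_sub t0hi) _; apply: sub_cover.
rewrite (link_link_vertex cB' t0c).
have c1E : #|t0 |: c| = #|c|.+1 by rewrite cardsU1 t0c.
have ltn1 : (#|cover (t0 |: c)| - #|t0 |: c| < n)%N.
  by rewrite cov1 c1E; move: lecn lec; clear; lia.
rewrite (IH _ _ ltn1 c1B) cov1 c1E.
have -> // : i - 1 - (#|cover c|%:Z - #|c|.+1%:Z) = i - (#|cover c|%:Z - #|c|%:Z).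
by clear; lia.
Qed.

End Subdivision.

(** * Cohen-Macaulay and PR complexes *)

Section CohenMacaulay.
Variables (V : finType) (K : fieldType).
Implicit Types (s t u : {set V}) (D X : {set {set V}}) (z : chain V K).

Definition facet_card D := (\max_(t in D) #|t|)%N.

(* Plain [dim] is MathComp's dimension of a vector space. *)
Lemma dimE D : Defs.dim D = (facet_card D)%:Z - 1. Proof. by []. Qed.

Lemma leq_facet_card D s : s \in D -> (#|s| <= facet_card D)%N.
Proof. by move=> sD; apply: (bigmax_sup s). Qed.

Lemma facet_card_attained D s : s \in D -> exists2 F, F \in D & #|F| = facet_card D.
Proof.
move=> sD; have D0 : (0 < #|D|)%N by rewrite (cardD1 s) sD.
by have [F FD e] := eq_bigmax_cond (fun t : {set V} => #|t|) D0; exists F.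
Qed.

Lemma link_card D s u : u \in link D s -> (#|s| + #|u| <= facet_card D)%N.
Proof.
rewrite in_link -setI_eq0 => /and3P[_ /eqP su /leq_facet_card].
by rewrite cardsU su cards0 subn0.
Qed.

Lemma supported_eq0 X i z : (forall u, u \in X -> #|u|%:Z <> i + 1) ->
  supported X i z -> z = 0.
Proof.
move=> Xi zX; apply/ffunP => t; rewrite ffunE.
by have [//|/zX[/Xi]] := eqVneq (z t) 0.
Qed.

Lemma acyclic_at_no_face X i : (forall u, u \in X -> #|u|%:Z <> i + 1) ->
  acyclic_at K X i.
Proof.
move=> Xi z zX _; exists 0; first exact: supported0.
by rewrite linear0 (supported_eq0 Xi zX).
Qed.

(** Besides the face, this gives [-1 <= i], so that [i] can be traded for a natural number. *)
Lemma homology_face X i : reduced_homology K X i != 0%VS ->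
  exists2 u, u \in X & #|u|%:Z = i + 1.
Proof.
move=> nz; suff /exists_inP[u uX /eqP ui] : [exists u in X, #|u|%:Z == i + 1] by exists u.
apply: contraR nz; rewrite negb_exists_in => /forall_inP h.
by apply/eqP/homology0P/acyclic_at_no_face => u /h/eqP.
Qed.

(** The link of a largest face has only the empty face, whose simplex is a cycle with nothing to
    bound it. *)
Lemma homology_facet D F : simplicial_complex D -> F \in D ->
  #|F| = facet_card D -> reduced_homology K (link D F) (-1) != 0%VS.
Proof.
move=> cD FD Fmax; apply/eqP => /homology0P H.
have L0 u : u \in link D F -> #|u| = 0%N by move=> /link_card; rewrite Fmax; lia.
have [||w wL] := H (simplex K set0).
- move=> t; rewrite ffunE; case: (eqVneq t set0) => [-> _|_]; last by rewrite eqxx.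
  by rewrite in_link (cD _ _ (sub0set F) FD) setU0 FD -setI_eq0 setI0 eqxx cards0.
- apply/ffunP => t; rewrite boundaryE ffunE big1 // => v vt.
  rewrite ffunE; case: (v |: t =P set0) => [e|_]; last by rewrite mulr0.
  by have := setU11 v t; rewrite e inE.
rewrite (supported_eq0 _ wL) => [|u /L0->]; last by lia.
rewrite linear0 => /ffunP/(_ set0); rewrite !ffunE eqxx => /esym/eqP.
by rewrite oner_eq0.
Qed.

Lemma cohen_macaulay_card D s i : cohen_macaulay K D -> s \in D ->
  reduced_homology K (link D s) i != 0%VS -> i = (facet_card D)%:Z - 1 - #|s|%:Z.
Proof.
move=> CM sD nz; apply/eqP; apply: contraR nz => /eqP ne.
by apply/eqP/CM.
Qed.

Lemma cohen_macaulay_PR D : cohen_macaulay K D -> PR K D.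
Proof.
move=> CM i s t _ sD tD /eqP/(cohen_macaulay_card CM sD)-> /eqP/(cohen_macaulay_card CM tD).
by lia.
Qed.

(** * Degree types of Cohen-Macaulay complexes *)

Lemma in_level D s j :
  (s \in level K D j) = (s \in D) && (reduced_homology K (link D s) (j%:Z - 1) != 0%VS).
Proof. by rewrite inE. Qed.

Lemma level_size_eq D j m : level K D j != set0 ->
  (forall s, s \in level K D j -> #|s| = m) -> level_size K D j = m.
Proof.
move=> /set0Pn[s0 s0j] h; apply/eqP; rewrite eqn_leq /level_size; apply/andP; split.
  by apply/bigmax_leqP => s /h->.
by rewrite -{1}(h _ s0j) (bigmax_sup s0).
Qed.

(** The Cohen-Macaulay condition makes [j] the top degree of the link of [s]. Were level [j] empty,
    contracting a cycle at a vertex [a] would give a boundary in the link of [a |: s], whose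
    dimension is too small; so the cycle would vanish on every face through [a]. *)
Lemma level_pred D j : simplicial_complex D -> cohen_macaulay K D ->
  level K D j.+1 != set0 -> level K D j != set0.
Proof.
move=> cD CM /set0Pn[s]; rewrite in_level (_ : j.+1%:Z - 1 = j%:Z); last by lia.
case/andP=> sD nz; have ij := cohen_macaulay_card CM sD nz.
apply: contra nz => /eqP lj0; apply/eqP/homology0P => z zL dz.
suff -> : z = 0 by exists 0; [exact: supported0|rewrite linear0].
apply/ffunP => u; rewrite ffunE; apply/eqP/negP => /negP zu.
have [uL uj] := zL _ zu.
have [a au] : exists a, a \in u by apply/set0Pn; rewrite -card_gt0; lia.
move: (uL); rewrite in_link => /and3P[_ su suD].
have as_ : a \notin s by rewrite (disjointFl su).
have asD : a |: s \in D.
  by apply: cD suD; rewrite setUC setUS // sub1set.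
have /homology0P H : reduced_homology K (link D (a |: s)) (j%:Z - 1) = 0%VS.
  have : a |: s \notin level K D j by rewrite lj0 inE.
  by rewrite in_level asD /= negbK => /eqP.
have [||w wL dw] := H (contraction a z).
- rewrite -link_link_vertex //; apply: supported_contraction; first exact: link_complex.
  by rewrite subrK.
- by rewrite boundary_contraction dz contraction0 oppr0.
(* [w] lives on faces with [j + 1] vertices, while faces of the link of [a |: s] have at most
   [j]. *)
have w0 : w = 0.
  apply: supported_eq0 wL => t /link_card; rewrite cardsU1 as_ add1n subrK; lia.
have /ffunP/(_ (u :\ a)) := dw; rewrite w0 linear0 !ffunE !inE eqxx /= setD1K //.
move=> /esym/eqP; rewrite mulf_eq0 (negPf zu) orbF /orient.
by rewrite signr_eq0.
Qed.

(** An empty maximum is [0], so positivity ensures that some level is inhabited. *)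
Lemma max_level_attained D : (0 < max_level K D)%N ->
  level K D (max_level K D) != set0.
Proof.
rewrite /max_level => p0.
have /(eq_bigmax_cond (fun i : 'I_#|V|.+1 => nat_of_ord i))[i] :
    (0 < #|[pred i : 'I_#|V|.+1 | level K D i != set0]|)%N.
  rewrite lt0n; apply: contraL p0 => /eqP/card0_eq h.
  by rewrite -leqNgt leqn0; apply/eqP; apply: big_pred0 => i; apply: h.
by move=> ilev; rewrite (eq_bigl (fun i : 'I_#|V|.+1 => level K D i != set0)) // => ->.
Qed.

Lemma leq_max_level D j : level K D j != set0 -> (j <= max_level K D)%N.
Proof.
move=> lj; have /set0Pn[s] := lj; rewrite in_level => /andP[_ /homology_face[u _ uj]].
have jV : (j < #|V|.+1)%N by have -> : j = #|u|; [lia|rewrite ltnS max_card].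
exact: (bigmax_sup (Ordinal jV)).
Qed.

(** Faces in level [k] have size [facet_card D - k], and every level up to the last is inhabited, so
    consecutive sizes differ by one. *)
Lemma cohen_macaulay_degree_type D : simplicial_complex D -> cohen_macaulay K D ->
  exists n, PR_of_degree_type K D (nseq n 1).
Proof.
move=> cD CM; exists (size (degree_type K D)).
split; first exact: cohen_macaulay_PR.
apply/all_pred1P; rewrite /degree_type all_map all_rev; apply/allP => j.
rewrite mem_iota => /andP[j0 jp] /=.
have nonempty k : (k <= max_level K D)%N -> level K D k != set0.
  move=> kp; have := max_level_attained (_ : 0 < max_level K D)%N.
  rewrite -(subnKC kp) => /(_ ltac:(lia)).
  by elim: (_ - _)%N => [|n IH]; rewrite ?addn0 // addnS => /(level_pred cD CM).
have size_ k : (k <= max_level K D)%N -> (level_size K D k + k = facet_card D)%N.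
  move=> kp; have ne := nonempty k kp; have /set0Pn[s sk] := ne.
  have h t : t \in level K D k -> (#|t| + k = facet_card D)%N.
    by rewrite in_level => /andP[tD] /(cohen_macaulay_card CM tD); lia.
  rewrite (@level_size_eq _ _ (facet_card D - k)) //; first by have := h s sk; lia.
  by move=> t /h; lia.
have := size_ j; have := size_ j.-1; lia.
Qed.

(** Level [0] contains the largest faces, which fixes its size; the unit steps then fix the size of
    every level up to the last, and [PR] makes it that of [s]. *)
Lemma degree_type_cohen_macaulay D n : simplicial_complex D ->
  PR_of_degree_type K D (nseq n 1) -> cohen_macaulay K D.
Proof.
move=> cD [prD deg] s sD i ne; apply/eqP; apply: contraT => nz; case: ne.
have [u uL ui] := homology_face nz.
have ij : i = #|u|%:Z - 1 by lia.
rewrite {i}ij in nz ui *; set j := #|u| in nz ui *.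
have sj : s \in level K D j by rewrite in_level sD.
have size_ k : level K D k != set0 -> forall t, t \in level K D k -> level_size K D k = #|t|.
  move=> lk t tk; apply: level_size_eq => // t'; move: tk; rewrite !in_level.
  by move=> /andP[tD /eqP tk] /andP[t'D /eqP t'k]; apply: (prD (k%:Z - 1)) => //; lia.
have [F FD Fmax] := facet_card_attained sD.
have F0 : F \in level K D 0 by rewrite in_level FD; apply: homology_facet.
have l0 : level_size K D 0 = facet_card D by rewrite (size_ _ _ _ F0) //; apply/set0Pn; exists F.
have step k : (k < max_level K D)%N -> (level_size K D k = (level_size K D k.+1).+1)%N.
  move=> kp; have : (level_size K D k)%:Z - (level_size K D k.+1)%:Z \in degree_type K D.
    by apply/mapP; exists k.+1; rewrite // mem_rev mem_iota; lia.
  by rewrite deg mem_nseq => /andP[_ /eqP]; lia.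
have down k : (k <= max_level K D)%N -> (level_size K D k + k = facet_card D)%N.
  elim: k => [|k IH] kp; first by rewrite addn0.
  by rewrite -(IH (ltnW kp)) (step k kp) addnS addSn.
have lj : level K D j != set0 by apply/set0Pn; exists s.
by have := down j (leq_max_level lj); rewrite (size_ _ lj s sj) dimE; lia.
Qed.

End CohenMacaulay.

(** * Passing between a complex and its subdivision *)

Section Main.
Variables (V : finType) (K : fieldType) (D : {set {set V}}).
Hypothesis cD : simplicial_complex D.
Implicit Types (s t u : {set V}) (c : {set {set V}}).

Lemma barycentric_complex : simplicial_complex (barycentric D).
Proof. exact: order_complex_complex. Qed.

(** The side condition rules out an empty flag over a nonempty [s]. Otherwise [s] goes on top of a
    flag with strictly smaller union, which is empty when a single member is wanted. *)
Lemma flag_exists s k : s \in D -> (k <= #|s|)%N -> (0 < k)%N || (s == set0) ->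
  exists c, [/\ c \in barycentric D, #|c| = k & cover c = s].
Proof.
elim: k s => [|k IH] s sD ks k0.
  exists set0; rewrite cards0 /cover big_set0; split=> //; last by rewrite (eqP k0).
  by apply/order_complexP; split=> t; rewrite inE.
have s0 : s != set0 by rewrite -card_gt0; apply: leq_trans ks.
have [c [cB ck cs]] : exists c, [/\ c \in barycentric D, #|c| = k & cover c \proper s].
  case: k => [|k] in IH ks {k0} *.
    exists set0; rewrite cards0 /cover big_set0 proper0; split=> //.
    by apply/order_complexP; split=> t; rewrite inE.
  have /set0Pn[v vs] := s0.
  have [|||c [cB ck cs]] := IH (s :\ v).
  - exact: cD (subD1set s v) sD.
  - by move: ks; rewrite (cardsD1 v s) vs add1n ltnS.
  - by [].
  by exists c; rewrite cs properD1.
have csub t : t \in c -> t \proper s by move=> tc; apply: sub_proper_trans cs; apply: sub_cover.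
have sc : s \notin c by apply/negP => /csub; rewrite properxx.
exists (s |: c); split.
- apply: order_complexU1 => // [|t /csub/proper_sub ts]; first by rewrite !inE s0.
  by rewrite /comparable_sets ts orbT.
- by rewrite cardsU1 sc ck.
- by rewrite /cover big_setU1 //=; apply/setUidPl/proper_sub.
Qed.

Lemma facet_card_barycentric : set0 \in D -> facet_card (barycentric D) = facet_card D.
Proof.
move=> D0; apply/eqP; rewrite eqn_leq; apply/andP; split.
  apply/bigmax_leqP => c cB; apply: leq_trans (card_order_complex (set0_notin_D1 D) cB) _.
  by apply/leq_facet_card/cover_barycentric.
have [F FD <-] := facet_card_attained D0.
have [|c [cB <- _]] := flag_exists FD (leqnn _); last exact: leq_facet_card.
by rewrite card_gt0 orNb.
Qed.

(** The degree shift turns [dim D - #|cover c|] into [dim D - #|c|], and subdividing preserves the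
    dimension. *)
Lemma cohen_macaulay_barycentric0 : set0 \in D ->
  cohen_macaulay K D -> cohen_macaulay K (barycentric D).
Proof.
move=> D0 CM c cB i ne; apply/homology0P/acyclic_at_link_barycentric => //.
apply/homology0P/CM; first exact: cover_barycentric.
by move: ne; rewrite !dimE facet_card_barycentric //; lia.
Qed.

Lemma PR_barycentric : PR K (barycentric D) -> cohen_macaulay K D.
Proof.
move=> prB s sD i ne; apply/eqP; apply: contraT => nz; case: ne.
have D0 : set0 \in D by apply: cD sD; apply: sub0set.
have [u uL ui] := homology_face nz; have dle := link_card uL.
have [F FD Fmax] := facet_card_attained sD; rewrite dimE.
(* This is [dim D - i]. For a flag of size [k] with union [F] the shift is [#|F| - k = i + 1], which
   leads to degree [-1], where the link of [F] has homology. *)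
pose k := (facet_card D - #|u|)%N.
have [ks|sk] : #|s| = k \/ (#|s| < k)%N by rewrite /k; lia.
  by move: ks; rewrite /k; lia.
have [||c [cB ck cF]] := @flag_exists F k FD; [by rewrite /k; lia|lia|].
have [|c' [c'B c'k c's]] := @flag_exists s #|s| sD (leqnn _); first by rewrite card_gt0 orNb.
(* Both flags have links with homology in degree [i], so [PR] equates [#|s|] with [k], against
   [sk]. *)
have : #|c'| = #|c|; last by lia.
apply: (prB i) => //; first by lia.
  move/homology0P/(acyclic_at_link_barycentric _ _ cD D0 c'B).
  by rewrite c's c'k subrr subr0 => /homology0P/eqP; rewrite (negPf nz).
move/homology0P/(acyclic_at_link_barycentric _ _ cD D0 cB)/homology0P/eqP.
rewrite cF ck (_ : i - _ = -1); last by rewrite Fmax /k; lia.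
by rewrite (negPf (homology_facet K cD FD Fmax)).
Qed.

End Main.

Lemma cohen_macaulay_barycentric (V : finType) (K : fieldType) (D : {set {set V}}) :
  simplicial_complex D -> cohen_macaulay K D -> cohen_macaulay K (barycentric D).
Proof.
move=> cD CM; case: (boolP (set0 \in D)) => D0; first exact: cohen_macaulay_barycentric0.
have -> : D = set0.
  apply/setP => s; rewrite inE; apply: contraNF D0 => sD.
  by apply: cD sD; apply: sub0set.
(* The empty flag exists even over the void complex. *)
have -> : barycentric (set0 : {set {set V}}) = barycentric [set set0].
  by rewrite /barycentric set0D setDv.
apply: cohen_macaulay_barycentric0; rewrite ?inE //.
  by move=> s t ts; rewrite !inE -!subset0 => /(subset_trans ts).
move=> s _ i; rewrite dimE /facet_card big_set1 cards0 => ne.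
apply/homology0P/acyclic_at_no_face => u; rewrite in_link !inE => /and3P[/eqP-> _].
case: (eqVneq s set0) ne => [->|s0]; rewrite ?setU0 ?cards0; first by lia.
by rewrite (negPf s0).
Qed.

Theorem proposition6p30 (K : fieldType) (V : finType) (D : {set {set V}})
    (D_complex : simplicial_complex D) :
  [<-> PR K (barycentric D);
       cohen_macaulay K (barycentric D);
       exists n : nat, PR_of_degree_type K (barycentric D) (nseq n 1);
       cohen_macaulay K D;
       exists n : nat, PR_of_degree_type K D (nseq n 1)].
Proof.
tfae.
(* This implication passes through [D]: down by [PR] and up again by the transfer to the
   subdivision. *)
- by move=> prB; apply/cohen_macaulay_barycentric/PR_barycentric.
- by apply: cohen_macaulay_degree_type; apply: barycentric_complex.
- by case=> n [prB _]; apply: PR_barycentric.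
- exact: cohen_macaulay_degree_type.
- case=> n prD; apply/cohen_macaulay_PR/cohen_macaulay_barycentric => //.
  exact: degree_type_cohen_macaulay prD.
Qed.
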